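(* Let $n\in\mathbb{N}$ with $n\ge 1$, let $\mathcal{F}\subseteq\mathbb{R}^n$ and $\mathcal{E}\subseteq\mathbb{R}^n$ be finite, non-empty sets of points, and let $h\in\mathbb{R}^n$. Then $h\in\operatorname{conv}(\mathcal{F})+\operatorname{cone}(\mathcal{E})$ if and only if there are sets $S_1,\ldots,S_n\in\bar{\mathcal{L}}^{U}$ and sets $S'_1,\ldots,S'_n\in\bar{\mathcal{L}}^{\mathbb{R}_+}$ such that $\bar\mu^{U}(S_i)+\bar\mu^{\mathbb{R}_+}(S'_i)=h_i$ for all $i\in\{1,\ldots,n\}$, $\bar\varphi^{U}(t,S_1,\ldots,S_n)\in\operatorname{conv}(\mathcal{F})$ for all $t\in U$, and $\bar\varphi^{\mathbb{R}_+}(t',S'_1,\ldots,S'_n)\in\operatorname{cone}(\mathcal{E})$ for all $t'\in\mathbb{R}_+$.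
   Context: Let $U=[0,1)$, $\mathbb{R}_+=[0,\infty)$, and let $Q$ be either $U$ or $\mathbb{R}_+$. $\operatorname{cone}(\mathcal{E})$ is the set of all finite non-negative linear combinations of points of $\mathcal{E}$ (it contains $0$). A rectangle over $Q$ is a pair $R=([a,b),c)$ with $a,b\in\mathbb{R}$, $[a,b)\subseteq Q$, $a<b$, $c\in\mathbb{R}$, $c\neq 0$; let $\mathcal{R}^Q$ be the set of all of them. Put $q(R)=(b-a)c$ (signed area) and $z(R)=c$ (signed height). For $t\in Q$ let $y(t,R)=1$ if $a\le t<b$ ($R$ is active at $t$) and $y(t,R)=0$ otherwise. Two rectangles $R_1,R_2$ are non-overlapping if there is no $t\in Q$ with $y(t,R_1)=y(t,R_2)=1$. $\bar{\mathcal{L}}^Q$ is the set of all finite (possibly empty) families $S=\{R_1,\ldots,R_k\}$ of pairwise non-overlapping rectangles from $\mathcal{R}^Q$, $k\in\mathbb{N}$ (with $0\in\mathbb{N}$). For such $S$, $\bar\mu^Q(S)=\sum_{i=1}^k q(R_i)$. For $t\in Q$ and $S\in\bar{\mathcal{L}}^Q$, $\bar\phi^Q(t,S)=z(R)$ if some (necessarily unique) $R\in S$ is active at $t$, and $\bar\phi^Q(t,S)=0$ otherwise. Finally, $\bar\varphi^Q(t,S_1,\ldots,S_n)=(\bar\phi^Q(t,S_1),\ldots,\bar\phi^Q(t,S_n))\in\mathbb{R}^n$. *)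

(* Defs.v *)
From mathcomp Require Import all_boot all_order all_algebra finmap.
From mathcomp Require Import boolp classical_sets cardinality set_interval reals.

Set Implicit Arguments.
Unset Strict Implicit.
Unset Printing Implicit Defensive.

Import Order.TTheory GRing.Theory Num.Theory.
Local Open Scope classical_set_scope.
Local Open Scope ring_scope.

Section Hulls.
Context {R : numDomainType} {V : lmodType R}.

Definition conv_hull (A : set V) : set V :=
  [set v | exists (k : nat) (w : 'I_k -> R) (x : 'I_k -> V),
    [/\ (forall i, 0 <= w i), \sum_i w i = 1, (forall i, A (x i)) &
        v = \sum_i w i *: x i]].

(* k = 0 is allowed, so that 0 always belongs to the cone *)
Definition cone_hull (A : set V) : set V :=
  [set v | exists (k : nat) (w : 'I_k -> R) (x : 'I_k -> V),
    [/\ (forall i, 0 <= w i), (forall i, A (x i)) & v = \sum_i w i *: x i]].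

Definition minkowski_sum (A B : set V) : set V :=
  [set x + y | x in A & y in B].

End Hulls.

(* the pair ([a, b), c) is encoded as the triple (a, b, c) *)
Notation rect R := (Real.sort R * Real.sort R * Real.sort R)%type.

Section Rectangles.
Context {R : realType}.

Definition rleft (r : rect R) : R := r.1.1.
Definition rright (r : rect R) : R := r.1.2.
Definition height (r : rect R) : R := r.2.
Definition area (r : rect R) : R := (rright r - rleft r) * height r.

Definition active (t : R) (r : rect R) : bool := rleft r <= t < rright r.

Definition Uitv : set R := `[0, 1[%classic.
Definition Rplus : set R := `[0, +oo[%classic.

Definition rectangles (Q : set R) : set (rect R) :=
  [set r | [/\ `[rleft r, rright r[%classic `<=` Q,
               rleft r < rright r & height r != 0]].

Definition non_overlapping (Q : set R) (r1 r2 : rect R) : Prop :=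
  ~ exists2 t, Q t & active t r1 /\ active t r2.

Definition Lbar (Q : set R) : set {fset rect R} :=
  [set S | (forall r, r \in S -> rectangles Q r) /\
           (forall r1 r2, r1 \in S -> r2 \in S -> r1 != r2 ->
              non_overlapping Q r1 r2)].

Definition mubar (S : {fset rect R}) : R := \sum_(r <- S) area r.

(* The height of the first active rectangle in the enumeration of S, and 0 if
   there is none; see phibar_active and phibar_inactive. *)
Definition phibar (t : R) (S : {fset rect R}) : R :=
  head 0 [seq height r | r <- S & active t r].

Definition varphibar (n : nat) (t : R) (S : 'I_n -> {fset rect R}) :
    'rV[R]_n :=
  \row_i phibar t (S i).

Lemma phibar_active (Q : set R) (S : {fset rect R}) (t : R) (r : rect R) :
  Lbar Q S -> Q t -> r \in S -> active t r -> phibar t S = height r.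
Proof.
move=> [_ dS] Qt rS tr; rewrite /phibar.
have : r \in [seq r <- S | active t r] by rewrite mem_filter tr.
case E : [seq r <- S | active t r] => [//|r' s] _ /=.
have : r' \in [seq r <- S | active t r] by rewrite E mem_head.
rewrite mem_filter => /andP[tr' r'S].
have [->//|ne] := eqVneq r' r.
by case: (dS _ _ r'S rS ne); exists t.
Qed.

Lemma phibar_inactive (S : {fset rect R}) (t : R) :
  (forall r, r \in S -> ~~ active t r) -> phibar t S = 0.
Proof.
move=> nS; rewrite /phibar.
case E : [seq r <- S | active t r] => [//|r s].
have : r \in [seq r <- S | active t r] by rewrite E mem_head.
by rewrite mem_filter => /andP[tr /nS]; rewrite tr.
Qed.

End Rectangles.

Arguments Uitv R : clear implicits.
Arguments Rplus R : clear implicits.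

(* Main.v *)
Require Import Defs.
From mathcomp Require Import all_boot all_order all_algebra finmap.
From mathcomp Require Import boolp classical_sets cardinality set_interval reals.
From mathcomp Require Import lra.

Import Order.TTheory GRing.Theory Num.Theory.
Local Open Scope classical_set_scope.
Local Open Scope ring_scope.

(** If [h = x + y], each coordinate of [x] and of [y] is realised by at most one
    rectangle over [[0, 1)], so the families take the constant values [x] and [y] there
    (and [0], a point of the cone, beyond).

    Conversely, [mubar] is the integral of the step function [phibar], and the
    integral of a function with values in a convex set or a cone stays there.
    Everything being piecewise constant, a finite sum replaces the integral: the
    endpoints of all rectangles of all [n] families, together with 0 and a common
    upper bound, form one grid [p_0 < p_1 < ... < p_m], on whose cells every
    family is constant, and [mubar (S i)] is the sum of
    [(p_{j+1} - p_j) * phibar p_j (S i)] with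
    coefficients that do not depend on [i] ([areas_riemann]).  So the vector of
    areas is a nonnegative combination of values of [varphibar], of total weight
    [p_m - p_0].  Over [[0, 1)] the grid runs from 0 to 1 and the combination is
    convex ([conv_hull_sum]); over the half-line it runs up to some bound of all
    the right endpoints, and the cone does not see the total weight
    ([cone_hull_sum]). *)

(** * Hulls and total weights *)

Section WeightedHull.
Context {R : numDomainType} {V : lmodType R}.
Implicit Types (A : set V) (s c : R) (v : V).

(** Recording the total weight lets one closure argument serve both hulls:
    weight 1 gives the convex hull, and arbitrary weight gives the cone.  In
    contrast with convex combinations, weighted ones add up without any
    renormalisation. *)
Definition weighted_hull A s v : Prop :=
  exists (k : nat) (w : 'I_k -> R) (x : 'I_k -> V),
    [/\ (forall i, 0 <= w i), \sum_i w i = s, (forall i, A (x i)) &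
        v = \sum_i w i *: x i].

Lemma cone_hullP A v : cone_hull A v <-> exists s, weighted_hull A s v.
Proof.
split=> [[k [w [x [w0 Ax ->]]]]|[s [k [w [x [w0 _ Ax ->]]]]]].
  by exists (\sum_i w i), k, w, x.
by exists k, w, x.
Qed.

Lemma weighted_hull0 A : weighted_hull A 0 0.
Proof. by exists 0%N, (fun=> 0), (fun=> 0); split=> [//|||]; rewrite ?big_ord0 //; case. Qed.

Lemma weighted_hullD A s1 v1 s2 v2 :
  weighted_hull A s1 v1 -> weighted_hull A s2 v2 ->
  weighted_hull A (s1 + s2) (v1 + v2).
Proof.
move=> [k1 [w1 [x1 [w1_ge0 <- Ax1 ->]]]] [k2 [w2 [x2 [w2_ge0 <- Ax2 ->]]]].
pose glue T (f1 : 'I_k1 -> T) (f2 : 'I_k2 -> T) (i : 'I_(k1 + k2)) :=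
  match split i with inl j => f1 j | inr j => f2 j end.
have glue_l T f1 f2 j : @glue T f1 f2 (lshift k2 j) = f1 j.
  by rewrite /glue (unsplitK (inl j)).
have glue_r T f1 f2 j : @glue T f1 f2 (rshift k1 j) = f2 j.
  by rewrite /glue (unsplitK (inr j)).
exists (k1 + k2)%N, (glue _ w1 w2), (glue _ x1 x2); split.
- by move=> i; rewrite /glue; case: split.
- by rewrite big_split_ord; congr +%R; apply: eq_bigr => j _;
    rewrite ?glue_l ?glue_r.
- by move=> i; rewrite /glue; case: split.
- by rewrite big_split_ord; congr +%R; apply: eq_bigr => j _;
    rewrite ?glue_l ?glue_r.
Qed.

Lemma weighted_hullZ A c s v :
  0 <= c -> weighted_hull A s v -> weighted_hull A (c * s) (c *: v).
Proof.
move=> c0 [k [w [x [w0 <- Ax ->]]]]; exists k, (fun i => c * w i), x.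
split=> //; first by move=> i; rewrite mulr_ge0.
  by rewrite mulr_sumr.
by rewrite scaler_sumr; apply: eq_bigr => i _; rewrite scalerA.
Qed.

Lemma weighted_hull_sum A m (d s : 'I_m -> R) (v : 'I_m -> V) :
  (forall j, 0 <= d j) -> (forall j, weighted_hull A (s j) (v j)) ->
  weighted_hull A (\sum_j d j * s j) (\sum_j d j *: v j).
Proof.
move=> d0 Av; elim/big_ind2: _ => [|s1 v1 s2 v2|j _].
- exact: weighted_hull0.
- exact: weighted_hullD.
- exact: weighted_hullZ.
Qed.

Lemma conv_hull_sum A m (d : 'I_m -> R) (v : 'I_m -> V) :
  (forall j, 0 <= d j) -> \sum_j d j = 1 ->
  (forall j, conv_hull A (v j)) -> conv_hull A (\sum_j d j *: v j).
Proof.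
move=> d0 d1 Av; have := weighted_hull_sum A m d (fun=> 1) v d0 Av.
by rewrite -mulr_suml d1 mulr1.
Qed.

Lemma cone_hull_sum A m (d : 'I_m -> R) (v : 'I_m -> V) :
  (forall j, 0 <= d j) ->
  (forall j, cone_hull A (v j)) -> cone_hull A (\sum_j d j *: v j).
Proof.
move=> d0 Av.
have /boolp.choice[s sAv] j : exists s, weighted_hull A s (v j) by apply/cone_hullP.
apply/cone_hullP.
by exists (\sum_j d j * s j); apply: weighted_hull_sum.
Qed.

Lemma cone_hull0 A : cone_hull A 0.
Proof. by apply/cone_hullP; exists 0; apply: weighted_hull0. Qed.

End WeightedHull.

(** * Sums over the cells of a grid *)

Section Grid.
Context {R : realType}.
Implicit Types (p s : seq R) (a b M : R).

Lemma ex_grid s M : 0 <= M -> (forall x, x \in s -> 0 <= x <= M) ->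
  exists p, [/\ sorted <%R p, {subset s <= p}, (0 < size p)%N,
    nth 0 p 0 = 0 & nth 0 p (size p).-1 = M].
Proof.
move=> M0 sM; pose p := sort <=%R (undup [:: 0, M & s]).
have memp x : (x \in p) = (x \in [:: 0, M & s]) by rewrite mem_sort mem_undup.
have pM x : x \in p -> 0 <= x <= M.
  by rewrite memp !inE => /or3P[/eqP->|/eqP->|/sM//]; rewrite lexx M0.
have p_gt0 : (0 < size p)%N.
  by have : 0 \in p; [rewrite memp mem_head | case: (p)].
have sp : sorted <=%R p by apply: sort_le_sorted.
have le_nth i j : (i <= j < size p)%N -> nth 0 p i <= nth 0 p j.
  move=> /andP[ij jp]; apply: (sorted_leq_nth le_trans le_refl) => //.
  by rewrite inE; apply: leq_ltn_trans jp.
exists p; split=> //.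
- by rewrite sort_lt_sorted undup_uniq.
- by move=> x xs; rewrite memp !inE xs !orbT.
- have /(nthP 0)[i ip pi] : 0 \in p by rewrite memp mem_head.
  apply/eqP; rewrite eq_le -{2}pi le_nth //=.
  by have /andP[] := pM _ (mem_nth 0 p_gt0).
- have /(nthP 0)[i ip pi] : M \in p by rewrite memp !inE eqxx orbT.
  have lp : ((size p).-1 < size p)%N by rewrite prednK.
  apply/eqP; rewrite eq_le; have /andP[_ ->] := pM _ (mem_nth 0 lp) => /=.
  by rewrite -{1}pi le_nth // lp andbT -ltnS prednK.
Qed.

(** As [b] is a grid point, it cannot fall strictly inside a cell, so each
    summand is the increment of [fun x => Num.min x b] and the sum telescopes. *)
Lemma grid_sum_below p b : sorted <%R p -> b \in p ->
  \sum_(j < (size p).-1) (nth 0 p j.+1 - nth 0 p j) * (nth 0 p j < b)%R%:R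
    = b - nth 0 p 0.
Proof.
move=> sp /(nthP 0)[i ip pi].
have p_gt0 : (0 < size p)%N by apply: leq_ltn_trans ip.
have le_p : {in [pred k | (k < size p)%N] &,
    {mono nth 0 p : k l / (k <= l)%N >-> k <= l}}.
  by apply: lt_sorted_leq_nth.
have lt_p : {in [pred k | (k < size p)%N] &,
    {mono nth 0 p : k l / (k < l)%N >-> k < l}}.
  by apply: lt_sorted_ltn_nth.
have lp : ((size p).-1 < size p)%N by rewrite prednK.
transitivity (\sum_(0 <= j < (size p).-1)
    (Num.min (nth 0 p j.+1) b - Num.min (nth 0 p j) b)).
  rewrite big_mkord; apply: eq_bigr => j _.
  have j1 : (j.+1 < size p)%N by rewrite -ltn_predRL.
  have j0 : (j < size p)%N by apply: ltnW.
  rewrite -pi; case: (ltnP j i) => ji.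
    by rewrite lt_p // ji mulr1 !min_l // le_p // ltnW.
  by rewrite lt_p // ltnNge ji mulr0 !min_r ?subrr // le_p // ltnW.
rewrite telescope_sumr // -pi; congr (_ - _).
  by rewrite min_r // le_p // -ltnS prednK.
by rewrite min_l // le_p.
Qed.

Lemma grid_sum p :
  \sum_(j < (size p).-1) (nth 0 p j.+1 - nth 0 p j)
    = nth 0 p (size p).-1 - nth 0 p 0.
Proof.
rewrite -(telescope_sumr (fun j => nth 0 p j) (leq0n _)).
by rewrite big_mkord.
Qed.

(** A point is in [[a, b)] when it is below [b] but not below [a]; as [a < b], the
    indicator is the difference of those of [grid_sum_below]. *)
Lemma grid_sum_active p (r : rect R) : sorted <%R p ->
  rleft r \in p -> rright r \in p -> rleft r < rright r ->
  \sum_(j < (size p).-1) (nth 0 p j.+1 - nth 0 p j) * (active (nth 0 p j) r)%:R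
    = rright r - rleft r.
Proof.
move=> sp pl pr lr.
have -> : rright r - rleft r = (rright r - nth 0 p 0) - (rleft r - nth 0 p 0).
  by lra.
rewrite -!(grid_sum_below _ _ sp) // -sumrB; apply: eq_bigr => j _; rewrite -mulrBr /active; congr (_ * _).
case: (leP (rleft r)) => [|jl] /=; first by rewrite subr0.
by rewrite (lt_trans jl lr) subrr.
Qed.

End Grid.

(** * Areas as sums of heights over grid cells *)

Section Areas.
Context {R : realType}.
Implicit Types (Q : set R) (S : {fset rect R}) (t : R).

(** Non-overlapping leaves at most one nonzero term.  In this linear form [phibar]
    can be exchanged with a sum over the cells of a grid. *)
Lemma phibar_sum Q S t : Lbar Q S -> Q t ->
  phibar t S = \sum_(r <- S) (active t r)%:R * height r.
Proof.
move=> LS Qt; case: (pselect (exists2 r, r \in S & active t r)) => [[r rS tr]|nS].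
  rewrite (phibar_active LS Qt rS tr) (bigD1_seq r) ?fset_uniq //= tr mul1r.
  rewrite big_seq_cond big1 ?addr0 // => r' /andP[r'S ne].
  case tr' : (active t r'); last by rewrite mul0r.
  by case: LS => _ /(_ _ _ r'S rS ne)[]; exists t.
have inS r : r \in S -> ~~ active t r by move=> rS; apply/negP => tr; apply: nS; exists r.
rewrite phibar_inactive // big_seq big1 // => r /inS/negbTE->.
by rewrite mul0r.
Qed.

Lemma mubar_grid p Q S : sorted <%R p -> Lbar Q S ->
  (forall r, r \in S -> rleft r \in p /\ rright r \in p) ->
  (forall j, (j < (size p).-1)%N -> Q (nth 0 p j)) ->
  mubar S = \sum_(j < (size p).-1)
    (nth 0 p j.+1 - nth 0 p j) * phibar (nth 0 p j) S.
Proof.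
move=> sp LS pS pQ.
under [RHS]eq_bigr => j _ do rewrite (phibar_sum _ _ _ LS (pQ _ (ltn_ord j))) mulr_sumr.
rewrite exchange_big /mubar big_seq [RHS]big_seq; apply: eq_bigr => r rS /=.
have [pl pr] := pS r rS.
have [/(_ r rS)[_ lr _] _] := LS.
rewrite /area -(grid_sum_active _ _ sp pl pr lr) mulr_suml.
by apply: eq_bigr => j _; rewrite mulrA.
Qed.

(** The integral over [[0, M)] of the step function [varphibar] is a Riemann sum
    on the grid of all endpoints.  The sample points lie in [Q] because the grid
    has no repetitions: every point but the last is below [M]. *)
Lemma areas_riemann Q n (S : 'I_n -> {fset rect R}) (M : R) :
  0 <= M -> `[0, M[ `<=` Q -> (forall i, Lbar Q (S i)) ->
  (forall i r, r \in S i -> 0 <= rleft r /\ rright r <= M) ->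
  exists (m : nat) (d t : 'I_m -> R),
    [/\ forall j, 0 <= d j, \sum_j d j = M, forall j, Q (t j) &
        \row_i mubar (S i) = \sum_j d j *: varphibar (t j) S].
Proof.
move=> M0 MQ LS SM.
pose ends := flatten [seq flatten [seq [:: rleft r; rright r] | r <- S i]
  | i <- enum 'I_n].
have endsP i r : r \in S i -> rleft r \in ends /\ rright r \in ends.
  by move=> rS; split; apply/flatten_mapP; exists i; rewrite ?mem_enum //;
    apply/flatten_mapP; exists r; rewrite // !inE eqxx ?orbT.
have endsM x : x \in ends -> 0 <= x <= M.
  move=> /flatten_mapP[i _ /flatten_mapP[r rS]].
  have [l0 rM] := SM i r rS; have [/(_ r rS)[_ lr _] _] := LS i.
  by rewrite !inE => /orP[/eqP->|/eqP->]; lra.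
have [p [sp endsp p_gt0 p0 pM]] := ex_grid ends M M0 endsM.
have lt_p : {in [pred k | (k < size p)%N] &,
    {mono nth 0 p : k l / (k < l)%N >-> k < l}} by apply: lt_sorted_ltn_nth.
have le_p : {in [pred k | (k < size p)%N] &,
    {mono nth 0 p : k l / (k <= l)%N >-> k <= l}} by apply: lt_sorted_leq_nth.
have lp : ((size p).-1 < size p)%N by rewrite prednK.
have pQ j : (j < (size p).-1)%N -> Q (nth 0 p j).
  move=> jp; have jp' := ltn_trans jp lp.
  by apply: MQ; rewrite /= in_itv /= -[X in _ < X]pM -[X in X <= _]p0 le_p // lt_p.
exists (size p).-1, (fun j => nth 0 p j.+1 - nth 0 p j), (fun j => nth 0 p j).
split.
- move=> j; have j1 : (j.+1 < size p)%N by rewrite -ltn_predRL.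
  by rewrite subr_ge0 le_p // inE ltnW.
- by rewrite grid_sum p0 pM subr0.
- by move=> j; apply: pQ.
- apply/rowP => i; rewrite mxE summxE (mubar_grid p Q) //.
    by apply: eq_bigr => j _; rewrite !mxE.
  by move=> r /endsP[/endsp ? /endsp ?].
Qed.

(** * Constant families *)

(** A rectangle must have nonzero height, hence the empty family for [c = 0]. *)
Definition unit_box (c : R) : {fset rect R} :=
  if c == 0 then fset0 else [fset (0, 1, c)]%fset.

Lemma Lbar_unit_box Q c : `[0, 1[ `<=` Q -> Lbar Q (unit_box c).
Proof.
move=> UQ; rewrite /unit_box; case: eqVneq => [_|c0]; first by split=> r; rewrite ?inE.
split=> [r|r1 r2]; rewrite !inE; first by move=> /eqP->; split.
by move=> /eqP-> /eqP->; rewrite eqxx.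
Qed.

Lemma mubar_unit_box c : mubar (unit_box c) = c.
Proof.
rewrite /mubar /unit_box; case: eqVneq => [->|_]; first by rewrite big_seq_fset0.
by rewrite big_seq_fset1 /area /= subr0 mul1r.
Qed.

Lemma phibar_unit_box c t : phibar t (unit_box c) = if 0 <= t < 1 then c else 0.
Proof.
have L := Lbar_unit_box setT c (fun _ _ => I).
rewrite (phibar_sum setT) // /unit_box; case: eqVneq => [->|_].
  by rewrite big_seq_fset0; case: ifP.
by rewrite big_seq_fset1 /active /=; case: ifP => _; rewrite ?mul1r ?mul0r.
Qed.

End Areas.
Theorem theorem4p5 (R : realType) (n : nat) (hn : (1 <= n)%N)
    (F E : set 'rV[R]_n) (h : 'rV[R]_n)
    (finF : finite_set F) (F0 : F !=set0)
    (finE : finite_set E) (E0 : E !=set0) :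
  minkowski_sum (conv_hull F) (cone_hull E) h <->
  exists (S S' : 'I_n -> {fset rect R}),
    [/\ (forall i, Lbar (Uitv R) (S i)) /\ (forall i, Lbar (Rplus R) (S' i)),
        forall i, mubar (S i) + mubar (S' i) = h ord0 i,
        forall t, Uitv R t -> conv_hull F (varphibar t S) &
        forall t', Rplus R t' -> cone_hull E (varphibar t' S')].
Proof.
have subRplus b : `[0, b[ `<=` Rplus R.
  by move=> t; rewrite /Rplus /= !in_itv /= => /andP[->].
split=> [[x Fx [y Ey <-]]|[S [S' [[LS LS'] Sh SF SE]]]].
  exists (fun i => unit_box (x ord0 i)), (fun i => unit_box (y ord0 i)).
  split=> [|i|t|t].
  - by split=> i; apply: Lbar_unit_box.
  - by rewrite !mubar_unit_box mxE.
  - rewrite /Uitv /= in_itv /= => t01.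
    suff -> : varphibar t (fun i => unit_box (x ord0 i)) = x by [].
    by apply/rowP => i; rewrite mxE phibar_unit_box t01.
  - move=> _; have [t01|t01] := boolP (0 <= t < 1).
      suff -> : varphibar t (fun i => unit_box (y ord0 i)) = y by [].
      by apply/rowP => i; rewrite mxE phibar_unit_box t01.
    suff -> : varphibar t (fun i => unit_box (y ord0 i)) = 0 by apply: cone_hull0.
    by apply/rowP => i; rewrite !mxE phibar_unit_box (negbTE t01).
exists (\row_i mubar (S i)); last first.
  exists (\row_i mubar (S' i)); last by apply/rowP => i; rewrite !mxE Sh.
  pose M := \big[Order.max/0]_i \big[Order.max/0]_(r <- S' i) rright r.
  have M0 : 0 <= M by apply: bigmax_ge_id.
  have SM i r : r \in S' i -> 0 <= rleft r /\ rright r <= M.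
    move=> rS; have [/(_ r rS)[rQ lr _] _] := LS' i.
    have := rQ (rleft r); rewrite /Rplus /= !in_itv /= lexx lr.
    move=> /(_ isT)/andP[l0 _]; split=> //.
    apply: (@le_trans _ _ (\big[Order.max/0]_(r <- S' i) rright r)).
      exact: le_bigmax_seq.
    exact: le_bigmax.
  have [m [d [t [d0 _ tQ ->]]]] := areas_riemann _ _ S' M M0 (subRplus M) LS' SM.
  by apply: cone_hull_sum => // j; apply: SE.
have SU i r : r \in S i -> 0 <= rleft r /\ rright r <= 1.
  move=> rS; have [/(_ r rS)[rU lr _] _] := LS i.
  have := rU (rleft r); rewrite /Uitv /= !in_itv /= lexx lr.
  move=> /(_ isT)/andP[l0 l1]; split=> //; rewrite leNgt; apply/negP => r1.
  (* otherwise 1 itself would be covered *)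
  have := rU 1; rewrite /Uitv /= !in_itv /= r1 ltxx ler01 (ltW l1).
  by move=> /(_ isT).
have [m [d [t [d0 d1 tU ->]]]] := areas_riemann (Uitv R) _ S 1 ler01 (@subset_refl _ _) LS SU.
by apply: conv_hull_sum => // j; exact: SF (tU j).
Qed.
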